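(* Let $f\in\mathcal{S}^{1,1}_{\mu,L}(\mathbb{R}^n)$ and $g\in\Gamma_0(\mathbb{R}^n)$, let $\varphi:=f+g$, and assume that the set $X^*$ of minimizers of $\varphi$ over $\mathbb{R}^n$ is nonempty, with minimal value $\bar\varphi$. Let $0<\eta\leq1$, let $x^0\in\mathbb{R}^n$ be arbitrary, and let $x^{k+1}=x^k-\frac{\eta}{L}\,\mathcal{G}(x^k,\frac{\eta}{L})$ for all $k\geq0$. Then $$\mathcal{C}_k:=\frac{\eta}{L}\,k\,\Big\|\mathcal{G}\big(x^k,\tfrac{\eta}{L}\big)\Big\|^2+\varphi(x^k)-\bar\varphi$$ is nonincreasing in $k\geq 0$, and for all $k\geq1$, $$\Big\|\mathcal{G}\big(x^k,\tfrac{\eta}{L}\big)\Big\|^2\leq\frac{L(\varphi(x^0)-\bar\varphi)}{\eta k}.$$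
   Context: Constants $L>0$ and $\mu\geq 0$. $\mathcal{S}^{1,1}_{\mu,L}(\mathbb{R}^n)$ is the class of differentiable functions $f:\mathbb{R}^n\to\mathbb{R}$ that are $L$-smooth and $\mu$-strongly convex, i.e. for all $x,y\in\mathbb{R}^n$: $f(y)\leq f(x)+\langle\nabla f(x),y-x\rangle+\frac{L}{2}\|y-x\|^2$ and $f(y)\geq f(x)+\langle\nabla f(x),y-x\rangle+\frac{\mu}{2}\|y-x\|^2$. $\Gamma_0(\mathbb{R}^n)$ is the class of proper closed convex functions $\mathbb{R}^n\to(-\infty,+\infty]$. The norm is the one induced by the inner product $\langle\cdot,\cdot\rangle$. The proximal mapping is $\mathbf{prox}_{tg}(x):=\arg\min_{y\in\mathbb{R}^n}\{g(y)+\frac{1}{2t}\|y-x\|^2\}$, and the proximal gradient mapping is $\mathcal{G}(x,t):=t^{-1}\left(x-\mathbf{prox}_{tg}(x-t\nabla f(x))\right)$ for $t>0$. The value $\varphi(x^0)=+\infty$ is allowed, in which case the inequalities are read in $(-\infty,+\infty]$. *)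

(* Defs.v *)
From mathcomp Require Import all_boot all_order all_algebra.
From mathcomp Require Import all_classical all_reals all_analysis.

Set Implicit Arguments.
Unset Strict Implicit.
Unset Printing Implicit Defensive.

Import Order.TTheory GRing.Theory Num.Theory.
Import numFieldNormedType.Exports.

Local Open Scope classical_set_scope.
Local Open Scope ring_scope.

(* R^n is 'rV[R]_n.  The library norm `|x| on 'rV[R]_n is the sup norm, so the
   Euclidean norm is defined here from the dot product; since all norms on R^n
   are equivalent, the library's [differentiable] and [closed] have their usual
   meaning. *)
Definition dotp (R : realType) (n : nat) (u v : 'rV[R]_n) : R :=
  \sum_(i < n) u 0 i * v 0 i.

Definition enorm (R : realType) (n : nat) (u : 'rV[R]_n) : R :=
  Num.sqrt (dotp u u).

Definition grad (R : realType) (n : nat) (f : 'rV[R]_n -> R) (x : 'rV[R]_n)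
    : 'rV[R]_n :=
  \row_(i < n) 'D_(delta_mx 0 i) f x.

Definition smooth_strongly_convex (R : realType) (n : nat) (mu L : R)
    (f : 'rV[R]_n -> R) : Prop :=
  [/\ forall x : 'rV[R]_n, differentiable f x,
      forall x y : 'rV[R]_n,
        f y <= f x + dotp (grad f x) (y - x) + L / 2 * enorm (y - x) ^+ 2
    & forall x y : 'rV[R]_n,
        f y >= f x + dotp (grad f x) (y - x) + mu / 2 * enorm (y - x) ^+ 2].

Definition proper (R : realType) (n : nat) (g : 'rV[R]_n -> \bar R) : Prop :=
  (forall x, g x != -oo%E) /\ (exists x, g x != +oo%E).

Definition epigraph (R : realType) (n : nat) (g : 'rV[R]_n -> \bar R)
    : set ('rV[R]_n * R) :=
  [set z | (g z.1 <= z.2%:E)%E].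

(* At t = 0 or t = 1 the convention 0 * +oo = 0 makes the inequality trivial. *)
Definition convex_efun (R : realType) (n : nat) (g : 'rV[R]_n -> \bar R)
    : Prop :=
  forall (x y : 'rV[R]_n) (t : R), 0 <= t <= 1 ->
    (g (t *: x + (1 - t) *: y)%R <= t%:E * g x + (1 - t)%:E * g y)%E.

Definition Gamma0 (R : realType) (n : nat) (g : 'rV[R]_n -> \bar R) : Prop :=
  [/\ proper g, closed (epigraph g) & convex_efun g].

Definition argmin (R : realType) (n : nat) (h : 'rV[R]_n -> \bar R)
    : set 'rV[R]_n :=
  [set x | forall y, (h x <= h y)%E].

(* For g in Gamma0 and t > 0 the minimizer exists and is unique; the default
   value 0 is only returned when there is no minimizer. *)
Definition prox (R : realType) (n : nat) (t : R) (g : 'rV[R]_n -> \bar R)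
    (x : 'rV[R]_n) : 'rV[R]_n :=
  xget 0 (argmin (fun y => (g y + ((2 * t)^-1 * enorm (y - x) ^+ 2)%:E)%E)).

Definition prox_grad_map (R : realType) (n : nat) (f : 'rV[R]_n -> R)
    (g : 'rV[R]_n -> \bar R) (x : 'rV[R]_n) (t : R) : 'rV[R]_n :=
  t^-1 *: (x - prox t g (x - t *: grad f x)).

(* Main.v *)
(* With t = eta / L and d = grad f(x^k) - grad f(x^{k+1}), the optimality
   condition of the prox makes G_k - d a subgradient of phi at x^{k+1}.
   Cocoercivity of grad f then yields
     phi(x^k) - phi(x^{k+1}) >= t/2 (|G_k|^2 + |G_k - d|^2),
   while |G_{k+1}| <= |G_k - d| <= |G_k|.  Hence phi drops by at least
   t |G_{k+1}|^2, which pays for the increase of the factor k in C_k.  The rate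
   is C_k <= C_0.  The prox is attained even when t = 1/L because its objective
   is strongly convex and, by the descent lemma for f, bounded below by the
   minimum of phi up to a constant. *)
Require Import Defs.
From mathcomp Require Import all_boot all_order all_algebra.
From mathcomp Require Import all_classical all_reals all_analysis.
From mathcomp Require Import ring lra.
Import Order.TTheory GRing.Theory Num.Theory.
Import numFieldNormedType.Exports.
Local Open Scope classical_set_scope.
Local Open Scope ring_scope.

(** * The Euclidean inner product *)

Section DotProduct.
Context {R : realType} {n : nat}.
Implicit Types (u v w : 'rV[R]_n) (a : R).

Lemma dotpC u v : dotp u v = dotp v u.
Proof. by apply: eq_bigr => i _; rewrite mulrC. Qed.

Lemma dotpDl u v w : dotp (u + v) w = dotp u w + dotp v w.
Proof. by rewrite -big_split; apply: eq_bigr => i _; rewrite mxE mulrDl. Qed.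

Lemma dotpZl a u v : dotp (a *: u) v = a * dotp u v.
Proof. by rewrite /dotp mulr_sumr; apply: eq_bigr => i _; rewrite mxE mulrA. Qed.

Lemma dotpNl u v : dotp (- u) v = - dotp u v.
Proof. by rewrite -scaleN1r dotpZl mulN1r. Qed.

Lemma dotpDr u v w : dotp u (v + w) = dotp u v + dotp u w.
Proof. by rewrite !(dotpC u) dotpDl. Qed.

Lemma dotpZr a u v : dotp u (a *: v) = a * dotp u v.
Proof. by rewrite !(dotpC u) dotpZl. Qed.

Lemma dotpNr u v : dotp u (- v) = - dotp u v.
Proof. by rewrite !(dotpC u) dotpNl. Qed.

Definition dotpE := (dotpDl, dotpDr, dotpNl, dotpNr, dotpZl, dotpZr).

Lemma dotp_ge0 u : 0 <= dotp u u.
Proof. by apply: sumr_ge0 => i _; rewrite -expr2 sqr_ge0. Qed.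

Lemma enorm_sqr u : enorm u ^+ 2 = dotp u u.
Proof. by rewrite /enorm sqr_sqrtr // dotp_ge0. Qed.

(** Balls of ['rV[R]_n] are sup-norm balls; this turns Euclidean estimates into coordinatewise
    ones. *)
Lemma sqr_coord_le_dotp u (j : 'I_n) : u 0 j ^+ 2 <= dotp u u.
Proof.
rewrite /dotp (bigD1 j) //= -expr2 lerDl.
by apply: sumr_ge0 => i _; rewrite -expr2 sqr_ge0.
Qed.

Lemma dotp_continuous : continuous (fun u : 'rV[R]_n => dotp u u).
Proof.
move=> u; rewrite /continuous_at /dotp.
apply: (@cvg_big _ _ _ _ _ add_continuous _ (nbhs u)) => i _.
by apply: cvgM; exact: coord_continuous.
Qed.

End DotProduct.

(** * Existence of the proximal point and its optimality condition *)

Section Prox.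
Context {R : realType} {n : nat}.
Implicit Types (g : 'rV[R]_n -> \bar R) (c y z p : 'rV[R]_n) (q t : R).

Lemma convex_efun_le g y z (a b t : R) : convex_efun g -> 0 <= t <= 1 ->
  (g y <= a%:E)%E -> (g z <= b%:E)%E ->
  (g (t *: y + (1 - t) *: z)%R <= (t * a + (1 - t) * b)%:E)%E.
Proof.
move=> cg t01 ya zb; apply: (le_trans (cg y z t t01)).
have /andP[t0 t1] := t01.
by rewrite [leRHS]EFinD !EFinM leeD // lee_wpmul2l // lee_fin // subr_ge0.
Qed.

Lemma proper_finite g : Defs.proper g -> exists y r, g y = r%:E.
Proof.
by case=> gNy [y gy]; exists y; case: (g y) (gNy y) gy => // r _ _; exists r.
Qed.

(* A minimizing sequence is Cauchy: by the parallelogram law the objective at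
   the midpoint of y and z is smaller than the average of its values at y and z
   by q / 4 * |y - z|^2. *)
Lemma argmin_prox_nonempty g c q m : Gamma0 g -> 0 < q ->
  (forall y, (m%:E <= g y + (q * enorm (y - c) ^+ 2)%:E)%E) ->
  exists p, argmin (fun y => (g y + (q * enorm (y - c) ^+ 2)%:E)%E) p.
Proof.
move=> [pg clg cg] q0 hm.
(* [inf S] is the infimum of the objective. Keeping [g] alone on the left lets closedness of the
   epigraph apply later. *)
pose S := [set s : R | exists y, (g y <= (s - q * dotp (y - c) (y - c))%:E)%E].
have Slb : lbound S m.
  move=> s [y gy]; rewrite -lee_fin; apply: (le_trans (hm y)).
  by rewrite enorm_sqr -leeBrDr // -EFinB.
have S0 : S !=set0.
  have [y [r gy]] := proper_finite _ pg.
  by exists (r + q * dotp (y - c) (y - c)), y; rewrite gy addrK.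
have Sinf : has_inf S by split=> //; exists m.
have Sle s y : (g y <= (s - q * dotp (y - c) (y - c))%:E)%E -> inf S <= s.
  by move=> gy; apply: ge_inf; [exists m | exists y].
have /choice[y hy] (k : nat) : exists y,
    (g y <= (inf S + k.+1%:R^-1 - q * dotp (y - c) (y - c))%:E)%E.
  have [s [y gy] sS] := @inf_adherent _ S k.+1%:R^-1 ltac:(by []) Sinf.
  by exists y; apply: (le_trans gy); rewrite lee_fin lerB // ltW.
have ydist k l : q * dotp (y k - y l) (y k - y l)
    <= 2 * (k.+1%:R^-1 + l.+1%:R^-1).
  have half01 : 0 <= (2^-1 : R) <= 1 by apply/andP; split; lra.
  have := convex_efun_le g (y k) (y l) _ _ 2^-1 cg half01 (hy k) (hy l).
  set a := dotp (y k - c) _; set b := dotp (y l - c) _ => gmid.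
  set z := _ + _ in gmid.
  have par : dotp (z - c) (z - c) =
      a / 2 + b / 2 - dotp (y k - y l) (y k - y l) / 4.
    have -> : z - c = 2^-1 *: (y k - c) + 2^-1 *: (y l - c).
      by apply/rowP => i; rewrite !mxE; field.
    have -> : y k - y l = (y k - c) - (y l - c) by rewrite opprB addrA subrK.
    rewrite /a /b !dotpE (dotpC (y l) (y k)) (dotpC c (y k)) (dotpC c (y l)).
    by field.
  (* This value, less q |z - c|^2, is exactly the convexity bound [gmid], so it belongs to [S]. *)
  have := Sle (inf S + (k.+1%:R^-1 + l.+1%:R^-1) / 2
     - q * dotp (y k - y l) (y k - y l) / 4) z.
  rewrite par => /(_ _); set d := dotp (y k - y l) _.
  set e := k.+1%:R^-1; set e' := l.+1%:R^-1.
  have -> : inf S + (e + e') / 2 - q * d / 4 - q * (a / 2 + b / 2 - d / 4) =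
     2^-1 * (inf S + e - q * a) + (1 - 2^-1) * (inf S + e' - q * b) by field.
  move=> /(_ gmid); lra.
have /cauchy_cvgP ycvg : cauchy (y @ \oo).
  apply/cauchy_ballP => e e0; near_simpl.
  (* If both reciprocals are below q e^2 / 4, then [ydist] gives q |y k - y l|^2 < q e^2. *)
  have e20 : 0 < q * e ^+ 2 / 4 by rewrite divr_gt0 // mulr_gt0 // exprn_gt0.
  have [N _ hN] := near_infty_natSinv_lt (PosNum e20).
  exists ([set k | (N <= k)%N], [set k | (N <= k)%N]) => /=.
    by split; exists N.
  move=> [k l] /= [Nk Nl]; split=> // i j; rewrite /ball /= ord1.
  have := sqr_coord_le_dotp (y k - y l) j; rewrite !mxE => hj.
  have := ydist k l; have /= hk := hN _ Nk; have /= hl := hN _ Nl.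
  move=> hd; rewrite -(ltr_pXn2r (n:=2)) ?nnegrE ?(ltW e0) //.
  rewrite -normrX ger0_norm ?sqr_ge0 //.
  rewrite -(ltr_pM2l q0); apply: (le_lt_trans (ler_wpM2l (ltW q0) hj)).
  apply: (le_lt_trans hd).
  have sum_lt (a b s : R) : a < s / 4 -> b < s / 4 -> 2 * (a + b) < s by lra.
  exact: sum_lt hk hl.
pose p := lim (y @ \oo).
have qcvg : q * dotp (y k - c) (y k - c) @[k --> \oo] -->
    q * dotp (p - c) (p - c).
  apply: cvgM; first exact: cvg_cst.
  apply: (@cvg_comp _ _ _ (fun k => y k - c) (fun u => dotp u u)).
    by apply: cvgB; [exact: ycvg | exact: cvg_cst].
  exact: dotp_continuous.
have gp : (g p <= (inf S - q * dotp (p - c) (p - c))%:E)%E.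
  pose F k := (y k, inf S + k.+1%:R^-1 - q * dotp (y k - c) (y k - c)).
  have : epigraph g (p, inf S - q * dotp (p - c) (p - c)).
    apply: (@closed_cvg _ _ \oo _ F) => //; first exact: nearW.
    have Fcvg : inf S + k.+1%:R^-1 - q * dotp (y k - c) (y k - c) @[k --> \oo]
        --> inf S - q * dotp (p - c) (p - c).
      apply: cvgB qcvg; rewrite -[X in _ --> X]addr0.
      by apply: cvgD; [exact: cvg_cst | exact: cvg_harmonic].
    by apply: (@cvg_pair _ _ _ \oo (nbhs p) _ _ _ _ _ _ ycvg Fcvg).
  by [].
exists p => z; apply: (@le_trans _ _ (inf S)%:E).
  by rewrite enorm_sqr -leeBrDr // -EFinB.
rewrite enorm_sqr; have := pg.1 z; case gz : (g z) => [r| |] // _.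
  rewrite lee_fin; apply: (Sle _ z); by rewrite gz addrK.
by rewrite addye // leey.
Qed.

(* Compare p with p + s (y - p), divide by s and let s tend to 0; the choice
   s = A / (A + B) below replaces the limit. *)
Lemma argmin_prox_subgrad g c p q : Defs.proper g -> convex_efun g -> 0 < q ->
  argmin (fun y => (g y + (q * enorm (y - c) ^+ 2)%:E)%E) p ->
  exists2 gp : R, g p = gp%:E &
    forall y r, (g y <= r%:E)%E -> gp + 2 * q * dotp (c - p) (y - p) <= r.
Proof.
move=> pg cg q0 pmin.
have [gp gpE] : exists gp, g p = gp%:E.
  have [y [r gy]] := proper_finite _ pg.
  have := pmin y; rewrite /= gy -EFinD; have := pg.1 p.
  by case: (g p) => // a _ _; exists a.
exists gp => // y r gy; rewrite leNgt; apply/negP => rlt.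
pose A := gp + 2 * q * dotp (c - p) (y - p) - r.
pose B := q * dotp (y - p) (y - p).
have A0 : 0 < A by rewrite subr_gt0.
have B0 : 0 <= B by rewrite mulr_ge0 ?dotp_ge0 // ltW.
have key s : 0 < s <= 1 -> A <= s * B.
  move=> /andP[s0 s1].
  have s01 : 0 <= s <= 1 by rewrite ltW.
  have gpr : (g p <= gp%:E)%E by rewrite gpE.
  have gs := convex_efun_le g y p r gp s cg s01 gy gpr.
  have := pmin (s *: y + (1 - s) *: p).
  rewrite /= gpE !enorm_sqr -EFinD => /le_trans /(_ (leeD2r _ gs)).
  rewrite -EFinD lee_fin.
  have -> : s *: y + (1 - s) *: p - c = s *: (y - p) - (c - p).
    by apply/rowP => i; rewrite !mxE; ring.
  rewrite -(opprB c p) /A /B; move: (y - p) (c - p) => u v.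
  rewrite !dotpE (dotpC v u) => H.
  rewrite -(ler_pM2l s0); nra.
(* At s = A / (A + B), [key] yields A (A + B) <= A B, hence A^2 <= 0. *)
have AB : 0 < A + B by rewrite ltr_pwDl.
have := key (A / (A + B)).
rewrite divr_gt0 // ler_pdivrMr // mul1r lerDl B0 => /(_ isT).
by rewrite mulrAC ler_pdivlMr // mulrDr gerDr leNgt mulr_gt0.
Qed.

(** Attainment excludes the default value [0] in [prox]. *)
Lemma argmin_prox g c t m : Gamma0 g -> 0 < t ->
  (forall y, (m%:E <= g y + ((2 * t)^-1 * enorm (y - c) ^+ 2)%:E)%E) ->
  argmin (fun y => (g y + ((2 * t)^-1 * enorm (y - c) ^+ 2)%:E)%E)
    (prox t g c).
Proof.
move=> hg t0 hm; apply: xgetPex.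
by apply: (argmin_prox_nonempty _ _ _ m hg) => //; rewrite invr_gt0 mulr_gt0.
Qed.

End Prox.

(** * Descent along one proximal gradient step, and the potential *)

Section ProxGradient.
Context {R : realType} {n : nat}.
Context (mu L : R) (f : 'rV[R]_n -> R) (g : 'rV[R]_n -> \bar R).
Context (L0 : 0 < L) (mu0 : 0 <= mu) (hf : smooth_strongly_convex mu L f).
Context (hg : Gamma0 g).
Implicit Types (x y p : 'rV[R]_n) (t m r : R).

Lemma smooth_ub x y :
  f y <= f x + dotp (grad f x) (y - x) + L / 2 * dotp (y - x) (y - x).
Proof. by rewrite -enorm_sqr; case: hf. Qed.

Lemma convex_lb x y : f x + dotp (grad f x) (y - x) <= f y.
Proof.
case: hf => _ _ /(_ x y); apply: le_trans.
by rewrite lerDl mulr_ge0 ?sqr_ge0 // divr_ge0.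
Qed.

(* Evaluate both inequalities at the gradient step y - (grad f y - grad f x)/L. *)
Lemma convex_smooth_lb x y :
  f x + dotp (grad f x) (y - x)
    + (2 * L)^-1 * dotp (grad f y - grad f x) (grad f y - grad f x) <= f y.
Proof.
have [d gyE] : exists d, grad f y = d + grad f x.
  by exists (grad f y - grad f x); rewrite subrK.
have := convex_lb x (y - L^-1 *: d).
have := smooth_ub y (y - L^-1 *: d).
rewrite gyE addrK.
have -> : y - L^-1 *: d - y = - (L^-1 *: d) by rewrite addrAC subrr add0r.
rewrite [y - _ - x]addrAC !dotpE.
set D := dotp d d; set E := dotp (grad f x) d.
have -> : L / 2 * - - (L^-1 * (L^-1 * D)) = (2 * L)^-1 * D by field; exact: lt0r_neq0.
have -> : L^-1 * D = 2 * ((2 * L)^-1 * D) by field; exact: lt0r_neq0.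
lra.
Qed.

(** With c = x - t grad f x and p = x - t G, the optimality condition makes (c - p) / t = G - grad f
    x a subgradient of [g] at p. The bound [m] ensures that the prox is attained. *)
Lemma prox_grad_subgrad x t m : 0 < t -> t * L <= 1 ->
    (forall y, (m%:E <= (f y)%:E + g y)%E) ->
  forall G, G = prox_grad_map f g x t ->
  exists2 gp : R, g (x - t *: G) = gp%:E &
    forall y r, (g y <= r%:E)%E ->
      gp + dotp (G - grad f x) (y - (x - t *: G)) <= r.
Proof.
move=> t0 tL hm G GE; pose c := x - t *: grad f x.
have pE : x - t *: G = prox t g c.
  by rewrite GE /prox_grad_map scalerA divff ?lt0r_neq0 // scale1r subKr.
have tL' : L / 2 <= (2 * t)^-1.
  by rewrite invfM mulrC ler_pM2l ?invr_gt0 // -[leRHS]mul1r ler_pdivlMr // mulrC.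
(* Expanding the square gives |y - c|^2 / (2t) = |y - x|^2 / (2t) + <grad f x, y - x> + t/2 |grad f
   x|^2. Since L/2 <= 1/(2t), the descent lemma bounds this below by f y - f x. *)
have lb y : ((m - f x)%:E <= g y + ((2 * t)^-1 * enorm (y - c) ^+ 2)%:E)%E.
  have := hm y; case: (g y) => [r|_|//=]; last by rewrite addye // leey.
  rewrite -!EFinD !lee_fin enorm_sqr => H.
  have := smooth_ub x y.
  have -> : y - c = (y - x) + t *: grad f x by rewrite /c opprB addrA addrAC.
  move: (y - x) => u; rewrite !dotpE (dotpC u (grad f x)).
  set D := dotp (grad f x) u => H1.
  have := ler_wpM2r (dotp_ge0 u) tL'; have := dotp_ge0 (grad f x).
  set E := dotp (grad f x) _; set q := (2 * t)^-1 => E0 H2.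
  have -> : q * (dotp u u + t * D + (t * D + t * (t * E))) =
    q * dotp u u + D + t / 2 * E by rewrite /q; field; exact: lt0r_neq0.
  have : 0 <= t / 2 * E by rewrite mulr_ge0 // divr_ge0 // ltW.
  lra.
have q0 : 0 < (2 * t)^-1 by rewrite invr_gt0 mulr_gt0.
have [pg _ cg] := hg.
have [gp] := argmin_prox_subgrad _ _ _ _ pg cg q0 (argmin_prox _ _ _ _ hg t0 lb).
rewrite -pE => gpE hgp; exists gp => // y r /hgp; congr (_ + _ <= _).
have -> : c - (x - t *: G) = t *: (G - grad f x).
  by apply/rowP => i; rewrite /c !mxE; ring.
by rewrite dotpZl; field; exact: lt0r_neq0.
Qed.

Lemma prox_grad_step x t m : 0 < t -> t * L <= 1 ->
    (forall y, (m%:E <= (f y)%:E + g y)%E) ->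
  forall G p G', G = prox_grad_map f g x t -> p = x - t *: G ->
    G' = prox_grad_map f g p t ->
  exists2 gp : R, g p = gp%:E &
    dotp G' G' <= dotp G G /\
    forall r, (g x <= r%:E)%E -> f p + gp + t * dotp G' G' <= f x + r.
Proof.
move=> t0 tL hm G p G' GE pE GE'.
have := prox_grad_subgrad x t m t0 tL hm G GE; rewrite -pE => -[gp gpE hp].
have [gp' gpE' hp'] := prox_grad_subgrad p t m t0 tL hm G' GE'.
exists gp; first exact: gpE.
have xp : x - p = t *: G by rewrite pE subKr.
have pp' : p - (p - t *: G') = t *: G' by rewrite subKr.
move: (p - t *: G') pp' gpE' hp' => p' pp' gpE' hp' {pE GE GE'}.
have [d fxE] : exists d, grad f x = d + grad f p.
  by exists (grad f x - grad f p); rewrite subrK.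
have tL2 : t / 2 <= (2 * L)^-1.
  by rewrite invfM mulrC ler_pM2l ?invr_gt0 // -[leRHS]mul1r ler_pdivlMr.
have d0 := dotp_ge0 d.
have Ld := ler_wpM2r d0 tL2.
have lbp := convex_smooth_lb p x; have lbx := convex_smooth_lb x p.
have dN : grad f p - grad f x = - d by rewrite fxE opprD addrCA subrr addr0.
rewrite -(opprB x p) dN xp fxE !dotpE opprK in lbx.
rewrite fxE addrK xp !dotpE in lbp.
(* Cocoercivity: the sum of [lbp] and [lbx] is |d|^2 / L <= t <d, G>. *)
have dG : dotp d d <= dotp d G by rewrite -(ler_pM2l t0); lra.
(* Monotonicity of the subdifferential of [g], tested at p and p'. *)
have mono : dotp G' G' <= dotp (G - d) G'.
  rewrite -(ler_pM2l t0).
  have := hp p' gp'; rewrite gpE' lexx => /(_ isT).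
  have := hp' p gp; rewrite gpE lexx => /(_ isT).
  rewrite -(opprB p p') pp' fxE !dotpE; lra.
have G'le : dotp G' G' <= dotp (G - d) (G - d).
  have := dotp_ge0 (G - d - G').
  rewrite [X in _ <= X]dotpDl dotpNl [in X in X - _]dotpDr [in X in _ - X]dotpDr.
  rewrite !dotpNr (dotpC G' (G - d)); lra.
have GdE : dotp (G - d) (G - d) = dotp G G - 2 * dotp d G + dotp d d.
  by rewrite !dotpE (dotpC G d); ring.
split=> [|r gx]; first lra.
(* Adding [hr] and [lbp], the decrease is at least t (|G|^2 - <d, G> + |d|^2 / 2). This exceeds t |G
   - d|^2 by t (<d, G> - |d|^2 / 2), which is nonnegative by [dG]. *)
have := hp x r gx; rewrite xp fxE !dotpE => hr.
have := ler_wpM2l (ltW t0) G'le; have := ler_wpM2l (ltW t0) dG.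
rewrite GdE !mulrDr mulrN mulrCA; nra.
Qed.

Lemma prox_grad_potential_nonincreasing (x G : nat -> 'rV[R]_n) t m :
    0 < t -> t * L <= 1 -> (forall y, (m%:E <= (f y)%:E + g y)%E) ->
    (forall k, G k = prox_grad_map f g (x k) t) ->
    (forall k, x k.+1 = x k - t *: G k) ->
  forall k l, (k <= l)%N ->
    ((t * l%:R * enorm (G l) ^+ 2)%:E + ((f (x l))%:E + g (x l))
       <= (t * k%:R * enorm (G k) ^+ 2)%:E + ((f (x k))%:E + g (x k)))%E.
Proof.
move=> t0 tL hm GE xE.
pose C k := ((t * k%:R * enorm (G k) ^+ 2)%:E + ((f (x k))%:E + g (x k)))%E.
apply: (@homo_leq _ C (fun a b => b <= a)%E) => [k|k l j lk kj|k].
- exact: lexx.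
- exact: le_trans kj lk.
rewrite /C !enorm_sqr.
have [gp gpE [GG desc]] := prox_grad_step (x k) t m t0 tL hm (G k) (x k.+1)
  (G k.+1) (GE k) (xE k) (GE k.+1).
have [[pg _] _ _] := hg.
rewrite gpE; have := pg (x k).
(* The value +oo can occur only at k = 0, since every later iterate is a prox point; the right-hand
   side is then +oo. *)
case gx : (g (x k)) => [r| |] // _; last by rewrite !addey // leey.
rewrite -!EFinD lee_fin.
have := desc r; rewrite gx lexx => /(_ isT).
have : t * k%:R * dotp (G k.+1) (G k.+1) <= t * k%:R * dotp (G k) (G k).
  by rewrite ler_wpM2l // mulr_ge0 // ltW.
rewrite -[k.+1]addn1 natrD; lra.
Qed.

End ProxGradient.

Theorem theorem4p1 (R : realType) (n : nat) (mu L : R)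
    (hL : 0 < L) (hmu : 0 <= mu)
    (f : 'rV[R]_n -> R) (hf : smooth_strongly_convex mu L f)
    (g : 'rV[R]_n -> \bar R) (hg : Gamma0 g)
    (phi : 'rV[R]_n -> \bar R) (hphi : forall x, phi x = ((f x)%:E + g x)%E)
    (phibar : \bar R)
    (hphibar : exists2 xstar, argmin phi xstar & phi xstar = phibar)
    (eta : R) (heta : 0 < eta <= 1)
    (x : nat -> 'rV[R]_n)
    (hx : forall k, x k.+1 =
      x k - (eta / L) *: prox_grad_map f g (x k) (eta / L)) :
  (forall k l : nat, (k <= l)%N ->
     ((eta / L * l%:R * enorm (prox_grad_map f g (x l) (eta / L)) ^+ 2)%:E
        + phi (x l) - phibar
      <= (eta / L * k%:R * enorm (prox_grad_map f g (x k) (eta / L)) ^+ 2)%:E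
        + phi (x k) - phibar)%E)
  /\
  (forall k : nat, (1 <= k)%N ->
     ((enorm (prox_grad_map f g (x k) (eta / L)) ^+ 2)%:E
      <= L%:E * (phi (x 0%N) - phibar) * ((eta * k%:R)^-1)%:E)%E).
Proof.
have /andP[eta0 eta1] := heta.
set t := eta / L in hx *.
have t0 : 0 < t by rewrite divr_gt0.
have tL : t * L <= 1 by rewrite divfK // lt0r_neq0.
have [pg _ _] := hg.
(* The minimal value is real: it lies below phi at a point where [g] is finite, and [g] never takes
   the value -oo. *)
have [m phibarE mle] : exists2 m, phibar = m%:E & forall y, (m%:E <= phi y)%E.
  case: hphibar => xs xsmin xsE; rewrite -xsE.
  have [y [r gy]] := proper_finite _ pg.
  have := xsmin y; rewrite /= !hphi gy -EFinD; have := pg.1 xs.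
  case gxs : (g xs) => [a| |] // _ _; exists (f xs + a) => // z.
  by have := xsmin z; rewrite /= [phi xs]hphi gxs -EFinD.
have hm y : (m%:E <= (f y)%:E + g y)%E by rewrite -hphi.
have Cdec := prox_grad_potential_nonincreasing mu L f g hL hmu hf hg x
  (fun k => prox_grad_map f g (x k) t) t m t0 tL hm (fun=> erefl) hx.
split=> [k l kl|k k1].
  by rewrite phibarE; apply: leeB; [rewrite !hphi; exact: Cdec | exact: lexx].
have k0 : 0 < k%:R :> R by rewrite ltr0n.
have ek0 : 0 < eta * k%:R by rewrite mulr_gt0.
(* The factor k removes the gradient term at index 0, and phi(x^k) >= phibar allows the gap at index
   k to be dropped. *)
have := Cdec 0%N k (leq0n k).
rewrite /= mulr0 mul0r add0e -!hphi phibarE; have := mle (x k).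
move: (enorm _ ^+ 2) => N.
have : phi (x 0%N) != -oo%E by have := mle (x 0%N); case: (phi (x 0%N)).
case: (phi (x 0%N)) => [a| |] // _; last first.
  move=> _ _; rewrite addye // gt0_muley ?lte_fin //.
  by rewrite gt0_mulye ?lte_fin ?invr_gt0 // leey.
case: (phi (x k)) => [b| |] //; rewrite -!EFinD -!EFinM !lee_fin => mb H.
rewrite ler_pdivlMr //.
have -> : N * (eta * k%:R) = L * (t * k%:R * N).
  by rewrite /t; field; rewrite lt0r_neq0.
by rewrite ler_pM2l //; lra.
Qed.
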